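(* Let $\sigma=(\sigma_0,\dots,\sigma_6)\in\{+,-\}^7$ and let $(P,N)$ be a pair of non-negative integers which is Descartes-compatible with $\sigma$. Then there exists a real polynomial of degree 6 with sign sequence $\sigma$ having exactly $P$ positive roots and exactly $N$ negative roots (counted with multiplicity), unless $(\sigma,(P,N))$ is trivially equivalent to one of the following, in which case no such polynomial exists: $$\bigl((+,+,-,+,-,+,+),\,(2,0)\bigr),\qquad \bigl((+,+,-,+,-,+,+),\,(4,0)\bigr),$$ $$\bigl((+,+,+,+,-,+,+),\,(2,0)\bigr),\qquad \bigl((+,+,-,-,-,-,+),\,(0,4)\bigr).$$
   Context: A real polynomial $Y(x)=a_0+a_1x+\cdots+a_dx^d$ of degree $d$ with all coefficients $a_0,\dots,a_d$ non-zero (a polynomial without gaps) has sign sequence $(\sigma_0,\dots,\sigma_d)$, where $\sigma_i$ is the sign of $a_i$; thus the first sign corresponds to the constant term. A variation in a sign sequence is an index $i$ with $\sigma_i=-\sigma_{i+1}$. A pair $(P,N)$ of non-negative integers is called Descartes-compatible with $\sigma=(\sigma_0,\dots,\sigma_d)$ if $k-P$ is even and non-negative, where $k$ is the number of variations of $\sigma$, and $k'-N$ is even and non-negative, where $k'$ is the number of variations of the sequence $((-1)^i\sigma_i)_{0\le i\le d}$. By Descartes' rule of signs, the numbers of positive and negative roots (counted with multiplicity) of a polynomial with sign sequence $\sigma$ always form a Descartes-compatible pair. Two such data $(\sigma,(P,N))$ are called trivially equivalent if one is obtained from the other by a composition of the following transformations: (1) changing $x$ into $-x$: $\bigl((\sigma_i)_{0\le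 i\le d},(P,N)\bigr)\mapsto\bigl(((-1)^i\sigma_i)_{0\le i\le d},(N,P)\bigr)$; (2) changing $x$ into $1/x$ (that is, $Y(x)$ into $x^dY(1/x)$): $\bigl((\sigma_i)_{0\le i\le d},(P,N)\bigr)\mapsto\bigl((\sigma_{d-i})_{0\le i\le d},(P,N)\bigr)$; (3) changing $Y$ into $-Y$: $\bigl((\sigma_i)_{0\le i\le d},(P,N)\bigr)\mapsto\bigl((-\sigma_i)_{0\le i\le d},(P,N)\bigr)$. *)

(* Defs.v *)
From mathcomp Require Import all_boot all_order all_algebra.
From mathcomp Require Import polyorder polyrcf reals.

Set Implicit Arguments.
Unset Strict Implicit.
Unset Printing Implicit Defensive.

Import Order.TTheory GRing.Theory Num.Theory.
Local Open Scope ring_scope.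

(* A sign is a boolean b standing for (-1) ^+ b, so true is the minus sign.
   Index 0 of a sign sequence corresponds to the constant term. *)
Notation sign_seq d := (d.+1.-tuple bool).
Notation pos := false (only parsing).
Notation neg := true (only parsing).

(* A sign sequence together with a pair (P, N). *)
Notation sign_data d := (sign_seq d * (nat * nat))%type.

Definition variations (d : nat) (sigma : sign_seq d) : nat :=
  #|[set i : 'I_d | tnth sigma (widen_ord (leqnSn d) i)
                      != tnth sigma (lift ord0 i)]|.

(* The sequence ((-1)^i sigma_i)_i *)
Definition alternate_signs (d : nat) (sigma : sign_seq d) : sign_seq d :=
  [tuple odd i (+) tnth sigma i | i < d.+1].

(* The sequence (sigma_(d-i))_i *)
Definition reverse_signs (d : nat) (sigma : sign_seq d) : sign_seq d :=
  [tuple tnth sigma (rev_ord i) | i < d.+1].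

(* The sequence (- sigma_i)_i *)
Definition opposite_signs (d : nat) (sigma : sign_seq d) : sign_seq d :=
  [tuple ~~ tnth sigma i | i < d.+1].

Definition Descartes_compatible (d : nat) (sigma : sign_seq d) (P N : nat) :=
  let k := variations sigma in
  let k' := variations (alternate_signs sigma) in
  [/\ (P <= k)%N, ~~ odd (k - P), (N <= k')%N & ~~ odd (k' - N)].

(* The three generators are involutions, so this relation is symmetric. *)
Inductive trivially_equivalent (d : nat) (D : sign_data d) :
    sign_data d -> Prop :=
  | TrivRefl : trivially_equivalent D D
  | TrivNegX sigma P N : trivially_equivalent D (sigma, (P, N)) ->
      trivially_equivalent D (alternate_signs sigma, (N, P))
  | TrivInvX sigma P N : trivially_equivalent D (sigma, (P, N)) ->
      trivially_equivalent D (reverse_signs sigma, (P, N))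
  | TrivNegY sigma P N : trivially_equivalent D (sigma, (P, N)) ->
      trivially_equivalent D (opposite_signs sigma, (P, N)).

(* Y has degree d, no zero coefficient, and sign sequence sigma. *)
Definition has_sign_seq (R : realType) (d : nat) (sigma : sign_seq d)
    (Y : {poly R}) :=
  size Y = d.+1 /\
  forall i : 'I_d.+1, Num.sg Y`_i = (-1) ^+ tnth sigma i.

(* rootsR lists the distinct real roots of a nonzero polynomial. *)
Definition nb_pos_roots (R : realType) (Y : {poly R}) : nat :=
  (\sum_(x <- rootsR Y | (0 < x)%R) \mu_x Y)%N.

Definition nb_neg_roots (R : realType) (Y : {poly R}) : nat :=
  (\sum_(x <- rootsR Y | (x < 0)%R) \mu_x Y)%N.

Definition realizes (R : realType) (d : nat) (sigma : sign_seq d) (P N : nat)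
    (Y : {poly R}) :=
  [/\ has_sign_seq sigma Y, nb_pos_roots Y = P & nb_neg_roots Y = N].

Definition exceptional_data : seq (sign_data 6) :=
  [:: ([tuple pos; pos; neg; pos; neg; pos; pos], (2, 0));
      ([tuple pos; pos; neg; pos; neg; pos; pos], (4, 0));
      ([tuple pos; pos; pos; pos; neg; pos; pos], (2, 0));
      ([tuple pos; pos; neg; neg; neg; neg; pos], (0, 4))]%N.

(* Main.v *)
Require Import Defs.
From mathcomp Require Import all_boot all_order all_algebra.
From mathcomp Require Import polyorder polyrcf reals.
From mathcomp Require Import ring lra.

(** Realizability is invariant under trivial equivalence: writing a real
    polynomial as a rootless factor times the product of the [X - r] over its
    real roots [r], each of the three transformations acts on that product
    root by root ([r] becomes [- r], [r^-1] or [r]), while the cofactor stays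
    rootless ([realizable_equiv]).  The theorem therefore only concerns the 91
    classes of compatible data: 4 of them are obstructed, and one polynomial
    has to be exhibited for each of the other 87.

    Three of the four obstructions have one cause ([not_realizable_odd_pos]):
    all coefficients of odd degree are positive, so [Y(x) > Y(-x)] for
    [x > 0]; if [Y] has a positive constant term and no negative root, then
    [Y(-x) > 0], hence no positive root either.

    The fourth datum ([not_realizable_four_neg]) would give
    [Y = (w X^2 + v X + u) (X + a) (X + b) (X + c) (X + d)] with
    [a, b, c, d > 0], [w > 0] and [v^2 < 4 w u].  With [e_k] the elementary
    symmetric functions of [a, b, c, d], the negative signs in degrees 5 and 2
    say [w e1 < - v] and [u e2 < - v e3 - w e4], and [6 e3 <= e1 e2] holds for
    nonnegative numbers.  Together,
    [6 w u e2 < 6 w (- v) e3 <= w e1 (- v) e2 < v^2 e2 < 4 w u e2],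
    which is absurd since [w u > 0].

    For existence, a polynomial of prescribed type can be perturbed and
    rescaled, without changing its signs or those of its real roots, so that
    its real roots are integers and its other factors are quadratics with
    integer coefficients.  Such a list of roots and quadratics is a
    certificate, and its datum is found by expanding the product over the
    integers ([certificate_realizable]).  The table [certificates] has one
    entry per class, and [certificates_cover] verifies by computation that
    every compatible datum is equivalent to an exceptional one or to the datum
    of a certificate. *)

Set Implicit Arguments.
Unset Strict Implicit.
Unset Printing Implicit Defensive.

Import Order.TTheory GRing.Theory Num.Theory.
Local Open Scope ring_scope.

(** * Real roots and their multiplicities from a factorization *)

Definition rootless (F : fieldType) (q : {poly F}) := forall x, ~~ root q x.

Lemma rootless_neq0 (F : fieldType) (q : {poly F}) : rootless q -> q != 0.
Proof. by move=> /(_ 0); apply: contraNneq => ->; apply: root0. Qed.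

Lemma rootlessM (F : fieldType) (p q : {poly F}) :
  rootless p -> rootless q -> rootless (p * q).
Proof. by move=> hp hq x; rewrite rootM negb_or hp hq. Qed.

Lemma split_real_roots (R : rcfType) (p : {poly R}) : p != 0 ->
  exists (q : {poly R}) (rs : seq R),
    rootless q /\ p = q * \prod_(r <- rs) ('X - r%:P).
Proof.
have [n] := ubnP (size p); elim: n p => // n IH p ltpn p0.
case Ers: (rootsR p) => [|r rs'].
  exists p, [::]; rewrite big_nil mulr1; split => // x; apply/negP => rx.
  have /(_ x) := roots_on_rootsR p0.
  by rewrite Ers in_nil rx in_itv.
have : root p r.
  have /(_ r) := roots_on_rootsR p0.
  by rewrite Ers in_itv inE eqxx.
move=> /factor_theorem[p' Dp].
have p'0 : p' != 0 by apply: contraNneq p0 => p'0; rewrite Dp p'0 mul0r.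
have [|q [rs [hq Dp']]] := IH p' _ p'0.
  by move: ltpn; rewrite Dp size_Mmonic ?monicXsubC// size_XsubC addn2.
by exists q, (r :: rs); split => //; rewrite big_cons mulrCA -Dp' mulrC.
Qed.

Lemma mu_prod_XsubC (R : rcfType) (q : {poly R}) (rs : seq R) x : rootless q ->
  \mu_x (q * \prod_(r <- rs) ('X - r%:P)) = count_mem x rs.
Proof.
move=> hq; have q0 := rootless_neq0 hq.
elim: rs => [|r rs IH]; first by rewrite big_nil mulr1 muNroot.
rewrite big_cons mulrCA mu_mul.
  rewrite IH /=; congr addn; case: eqVneq => [->|nrx]; first exact: mu_XsubC.
  by rewrite muNroot // root_XsubC eq_sym.
rewrite !mulf_neq0 ?polyXsubC_eq0//.
by apply/monic_neq0/monic_prod_XsubC.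
Qed.

(** Both [nb_pos_roots] and [nb_neg_roots] are sums of this form, so a
    factorization with rootless cofactor reduces them to counting in a list. *)
Lemma count_roots_split (R : rcfType) (A : pred R) (q : {poly R}) (rs : seq R) :
  rootless q ->
  let p := q * \prod_(r <- rs) ('X - r%:P) in
  (\sum_(x <- rootsR p | A x) \mu_x p)%N = count A rs.
Proof.
move=> hq p; have q0 := rootless_neq0 hq.
have p0 : p != 0 by rewrite mulf_neq0// monic_neq0// monic_prod_XsubC.
have mem_rs : rootsR p =i undup rs.
  move=> x; have := roots_on_rootsR p0 x.
  rewrite in_itv /= mem_undup => <-.
  by rewrite rootM (negPf (hq x)) root_prod_XsubC.
have uniq_rs : uniq (rootsR p) by apply: uniq_roots.
rewrite (perm_big _ (uniq_perm uniq_rs (undup_uniq rs) mem_rs)) /=.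
rewrite -sum1_count -[RHS]big_undup_iterop_count; apply: eq_bigr => x _.
by rewrite mu_prod_XsubC // Monoid.iteropE iter_addn mul1n addn0.
Qed.

Lemma no_root_in (R : rcfType) (A : pred R) (p : {poly R}) x : p != 0 ->
  (\sum_(x <- rootsR p | A x) \mu_x p)%N = 0%N -> A x -> ~~ root p x.
Proof.
move=> p0; have [q [rs [hq ->]]] := split_real_roots p0.
rewrite count_roots_split // => count0 Ax.
rewrite rootM negb_or hq root_prod_XsubC.
move: count0 => /eqP; rewrite -leqn0 leqNgt -has_count.
by apply: contraNN => xrs; apply/hasP; exists x.
Qed.

(** * Invariance under trivial equivalence *)

Definition realizable (R : realType) (d : nat) (D : sign_data d) :=
  exists Y : {poly R}, realizes D.1 D.2.1 D.2.2 Y.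

Lemma has_sign_seq_neq0 (R : realType) d (sigma : sign_seq d) (Y : {poly R}) :
  has_sign_seq sigma Y -> Y != 0.
Proof. by case=> sY _; rewrite -size_poly_gt0 sY. Qed.

Lemma signP (R : realDomainType) (x : R) (b : bool) :
  Num.sg x = (-1) ^+ b -> x != 0 /\ (x < 0) = b.
Proof.
case: b => /eqP; rewrite ?expr1 ?expr0 ?sgr_cp0 => hx.
  by rewrite lt_eqF // hx.
by rewrite gt_eqF // lt_gtF.
Qed.

Lemma realizable_opp (R : realType) d sigma P N :
  @realizable R d (sigma, (P, N)) -> realizable R (opposite_signs sigma, (P, N)).
Proof.
case=> Y [hY /= hP hN]; have [q [rs [hq DY]]] := split_real_roots (has_sign_seq_neq0 hY).
have hq' : rootless (- q) by move=> x; rewrite rootN.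
exists (- Y); split => /=.
- case: hY => sY cY; split; first by rewrite size_polyN.
  by move=> i; rewrite coefN sgrN cY tnth_mktuple signrN.
- by rewrite -hP /nb_pos_roots DY -mulNr !count_roots_split.
- by rewrite -hN /nb_neg_roots DY -mulNr !count_roots_split.
Qed.

Lemma coef_comp_polyNX (R : comNzRingType) (p : {poly R}) i :
  (p \Po - 'X)`_i = (-1) ^+ i * p`_i.
Proof.
elim/poly_ind: p i => [|p c IH] [|i]; rewrite ?comp_poly0 ?coef0 ?mulr0 //.
  by rewrite comp_poly_MXaddC mulrN coefD coefN !coefMX /= oppr0 mul1r coefD coefMX.
rewrite comp_poly_MXaddC mulrN !coefD coefN !coefMX IH !coefC /=.
by rewrite !addr0 exprS mulN1r mulNr.
Qed.

(** The sign produced by each factor, [- X - r = - (X - (- r))], is absorbed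
    in the rootless cofactor. *)
Lemma prod_XsubC_compNX (R : rcfType) (q : {poly R}) rs : rootless q ->
  exists2 q', rootless q' &
    (q * \prod_(r <- rs) ('X - r%:P)) \Po - 'X =
    q' * \prod_(r <- [seq - r | r <- rs]) ('X - r%:P).
Proof.
move=> hq; elim: rs => [|r rs [q' hq' E]].
  exists (q \Po - 'X); last by rewrite !big_nil !mulr1.
  by move=> x; rewrite rootE horner_comp; apply: hq.
exists (- q'); first by move=> x; rewrite rootN.
rewrite /= !big_cons mulrCA comp_polyM E comp_polyB comp_polyX comp_polyC.
by rewrite polyCN; ring.
Qed.

Lemma realizable_alt (R : realType) d sigma P N :
  @realizable R d (sigma, (P, N)) -> realizable R (alternate_signs sigma, (N, P)).
Proof.
case=> Y [hY /= hP hN]; have [q [rs [hq DY]]] := split_real_roots (has_sign_seq_neq0 hY).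
have [q' hq' DY'] := prod_XsubC_compNX rs hq.
exists (Y \Po - 'X); split => /=.
- case: hY => sY cY; split.
    by rewrite size_comp_poly2 // size_polyN size_polyX.
  move=> i; rewrite coef_comp_polyNX sgrM cY tnth_mktuple signr_addb signr_odd.
  by rewrite sgrX sgrN sgr1.
- rewrite -hN /nb_pos_roots /nb_neg_roots DY DY' !count_roots_split //.
  by rewrite count_map; apply: eq_count => r /=; rewrite oppr_gt0.
- rewrite -hP /nb_pos_roots /nb_neg_roots DY DY' !count_roots_split //.
  by rewrite count_map; apply: eq_count => r /=; rewrite oppr_lt0.
Qed.

(** This is [X^n p(1/X)], for [p] of degree at most [n]; the bound is explicit
    so that the operation is multiplicative in the lemmas below. *)
Definition reciprocal (R : nzRingType) n (p : {poly R}) :=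
  \poly_(i < n.+1) p`_(n - i).

Lemma horner_reciprocal (F : fieldType) n (p : {poly F}) x :
  (size p <= n.+1)%N -> x != 0 ->
  (reciprocal n p).[x] = x ^+ n * p.[x^-1].
Proof.
move=> sp x0; rewrite horner_poly (horner_coef_wide _ sp) mulr_sumr.
rewrite (reindex_inj rev_ord_inj) /=; apply: eq_bigr => i _.
have lein : (i <= n)%N by rewrite -ltnS.
by rewrite subSS subKn // mulrCA exprVn -expfB_cond ?(negPf x0).
Qed.

Lemma reciprocal_mulXsubC (R : comNzRingType) n (p : {poly R}) r :
  (size p <= n.+1)%N ->
  reciprocal n.+1 (p * ('X - r%:P)) = reciprocal n p * (1 - r *: 'X).
Proof.
move=> sp; apply/polyP => i.
rewrite [in RHS]mulrBr mulr1 -scalerAr !(coefB, coefZ, coefMX, coef_poly).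
rewrite mulrBr coefB coefMX coefMC.
case: i => [|i] /=.
  by rewrite !subn0 [p`_n.+1]nth_default // mul0r mulr0 subr0.
rewrite !ltnS subSS [p`__ * r]mulrC; case: (ltngtP i n) => [lin||->].
- by rewrite -(subnSK lin).
- by rewrite mulr0 subr0.
- by rewrite subnn.
Qed.

(** Each factor contributes [1 - r X = - r (X - r^-1)].  The reciprocal of the
    rootless [q] does not vanish at 0 because its value there is the leading
    coefficient of [q]. *)
Lemma reciprocal_prod_XsubC (F : fieldType) n (q : {poly F}) rs :
  size q = n.+1 -> rootless q -> 0 \notin rs ->
  exists2 q', rootless q' &
    reciprocal (n + size rs) (q * \prod_(r <- rs) ('X - r%:P)) =
    q' * \prod_(r <- [seq r^-1 | r <- rs]) ('X - r%:P).
Proof.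
move=> sq hq; elim: rs => [|r rs IH].
  move=> _; exists (reciprocal n q); last by rewrite !big_nil !mulr1 addn0.
  move=> x; rewrite rootE; have [->|x0] := eqVneq x 0.
    rewrite horner_coef0 coef_poly /= subn0.
    by have := rootless_neq0 hq; rewrite -lead_coef_eq0 /lead_coef sq.
  by rewrite horner_reciprocal ?sq // mulf_neq0 ?expf_neq0 //; apply: hq.
rewrite inE negb_or eq_sym => /andP[r0 /IH[q' hq' E]].
exists (- r *: q'); first by move=> x; rewrite rootZ ?oppr_eq0.
rewrite /= !big_cons mulrCA mulrC addnS reciprocal_mulXsubC; last first.
  rewrite size_Mmonic ?rootless_neq0 ?monic_prod_XsubC //.
  by rewrite size_prod_XsubC sq addnS.
have -> : 1 - r *: 'X = - r *: ('X - r^-1%:P).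
  by rewrite scaleNr -scalerN opprB scalerBr scale_polyC mulfV.
rewrite E -scalerAr -[RHS]scalerAl.
by rewrite -mulrA; congr (_ *: (_ * _)); rewrite mulrC.
Qed.

Lemma realizable_rev (R : realType) d sigma P N :
  @realizable R d (sigma, (P, N)) -> realizable R (reverse_signs sigma, (P, N)).
Proof.
case=> Y [hY /= hP hN]; have [q [rs [hq DY]]] := split_real_roots (has_sign_seq_neq0 hY).
have [sY cY] := hY.
have Y0 : Y`_0 != 0 by have /signP[] := cY ord0.
have rs0 : 0 \notin rs.
  apply: contraNN Y0; rewrite -horner_coef0 -/(root Y 0) DY rootM => rs0.
  by rewrite root_prod_XsubC rs0 orbT.
have /eqP sq : (size q + size rs == d.+1)%N.
  rewrite -sY DY size_Mmonic ?rootless_neq0 ?monic_prod_XsubC //.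
  by rewrite size_prod_XsubC addnS.
have [n Dn] : exists n, size q = n.+1.
  by case: (size q) (rootless_neq0 hq) (size_poly_gt0 q) => [->|n] //; exists n.
have Dd : d = (n + size rs)%N by move: sq; rewrite Dn => -[].
have [q' hq' DY'] := reciprocal_prod_XsubC Dn hq rs0.
rewrite -DY -Dd in DY'.
exists (reciprocal d Y); split => /=.
- split; first by rewrite size_poly_eq // subnn.
  move=> i; rewrite coef_poly ltn_ord tnth_mktuple -cY /=.
  by rewrite subSS.
- rewrite -hP /nb_pos_roots DY' DY !count_roots_split // count_map.
  by apply: eq_count => r /=; rewrite invr_gt0.
- rewrite -hN /nb_neg_roots DY' DY !count_roots_split // count_map.
  by apply: eq_count => r /=; rewrite invr_lt0.
Qed.

Lemma realizable_equiv (R : realType) d (D D' : sign_data d) :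
  trivially_equivalent D D' -> realizable R D' <-> realizable R D.
Proof.
elim=> [//|sigma P N _ <-|sigma P N _ <-|sigma P N _ <-]; split.
- move=> /realizable_alt; congr (realizable _ (_, _)); apply: eq_from_tnth => i.
  by rewrite !tnth_mktuple addKb.
- exact: realizable_alt.
- move=> /realizable_rev; congr (realizable _ (_, _)); apply: eq_from_tnth => i.
  by rewrite !tnth_mktuple rev_ordK.
- exact: realizable_rev.
- move=> /realizable_opp; congr (realizable _ (_, _)); apply: eq_from_tnth => i.
  by rewrite !tnth_mktuple negbK.
- exact: realizable_opp.
Qed.

(** * Obstructions *)

(** [Y(x) - Y(-x)] is twice the odd part of [Y], which is nonnegative at
    [x > 0]; and [Y(-x)] is positive, for [Y] would otherwise vanish on
    [[-x, 0[]. *)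
Lemma no_pos_root_of_odd_coefs_ge0 (R : rcfType) (Y : {poly R}) :
  (forall i, odd i -> 0 <= Y`_i) -> 0 < Y`_0 ->
  (forall x, x < 0 -> ~~ root Y x) -> forall x, 0 < x -> ~~ root Y x.
Proof.
move=> Yodd Y0 Yneg x x0.
have Yx : 0 < Y.[- x].
  rewrite ltNge; apply/negP => Yx.
  have [||z /andP[_ z0] rz] := @poly_ivt _ Y (- x) 0.
    by rewrite oppr_le0 ltW.
    by apply/andP; split; rewrite ?horner_coef0 ?(ltW Y0).
  have: z < 0.
    rewrite lt_neqAle z0 andbT; apply: contraTneq rz => ->.
    by rewrite rootE horner_coef0 gt_eqF.
  by move/Yneg; rewrite rz.
rewrite rootE gt_eqF // (lt_le_trans Yx) // !horner_coef ler_sum // => i _.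
rewrite exprNn mulrCA; case oddi: (odd i); rewrite -signr_odd oddi ?mul1r //.
rewrite expr1 mulN1r lerNl -subr_ge0 opprK addr_ge0 // mulr_ge0 ?Yodd //.
all: exact/exprn_ge0/ltW.
Qed.

(** [e1 e2 - 6 e3] is half the sum, over the triples [{x, y, z}], of
    [x (y - z)^2 + y (z - x)^2 + z (x - y)^2]. *)
Lemma esym4_ineq (R : realFieldType) (a b c d : R) :
  0 <= a -> 0 <= b -> 0 <= c -> 0 <= d ->
  6 * (a * b * c + a * b * d + a * c * d + b * c * d) <=
  (a + b + c + d) * (a * b + a * c + a * d + b * c + b * d + c * d).
Proof.
move=> a0 b0 c0 d0; rewrite -subr_ge0.
pose t (x y z : R) := x * (y - z) ^+ 2 + y * (z - x) ^+ 2 + z * (x - y) ^+ 2.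
have t0 x y z : 0 <= x -> 0 <= y -> 0 <= z -> 0 <= t x y z.
  by move=> x0 y0 z0; rewrite !addr_ge0 // mulr_ge0 // sqr_ge0.
have -> : (a + b + c + d) * (a * b + a * c + a * d + b * c + b * d + c * d)
    - 6 * (a * b * c + a * b * d + a * c * d + b * c * d)
    = (t a b c + t a b d + t a c d + t b c d) / 2.
  by rewrite /t; field.
by rewrite divr_ge0 // addr_ge0 ?t0 // addr_ge0 ?t0 // addr_ge0 ?t0.
Qed.

(** With [q = w X^2 + v X + u], the two negative coefficients force [- v] to be
    large compared with [w e1] and with [u e2 / e3]; since [6 e3 <= e1 e2], the
    product of the two bounds exceeds the discriminant bound [v^2 < 4 w u]. *)
Lemma quadratic_four_neg_roots (R : rcfType) (q : {poly R}) (a b c d : R) :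
  size q = 3 -> rootless q -> 0 < q`_2 ->
  0 < a -> 0 < b -> 0 < c -> 0 < d ->
  let Y := q * ('X + a%:P) * ('X + b%:P) * ('X + c%:P) * ('X + d%:P) in
  Y`_5 < 0 -> Y`_2 < 0 -> False.
Proof.
move=> sq hq q2 a0 b0 c0 d0 Y Y5 Y2.
have disc := introT (Num.Theory.Pdeg2.Real.deg2_poly_noroot sq) hq.
have qhigh i : q`_i.+3 = 0 by rewrite nth_default // sq.
have coefMXaddC (p : {poly R}) x i :
    (p * ('X + x%:P))`_i = (if i is j.+1 then p`_j else 0) + p`_i * x.
  by rewrite mulrDr coefD coefMX coefMC; case: i.
pose e1 := a + b + c + d.
pose e2 := a * b + a * c + a * d + b * c + b * d + c * d.
pose e3 := a * b * c + a * b * d + a * c * d + b * c * d.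
pose e4 := a * b * c * d.
have e20 : 0 < e2 by rewrite !addr_gt0 // mulr_gt0.
have e30 : 0 < e3 by rewrite !addr_gt0 // !mulr_gt0.
have e40 : 0 < e4 by rewrite !mulr_gt0.
have e_ineq : 6 * e3 <= e1 * e2 by apply: esym4_ineq; apply: ltW.
have {}Y5 : q`_1 + q`_2 * e1 < 0.
  by move: Y5; rewrite /Y !coefMXaddC !qhigh /e1; congr (_ < _); ring.
have {}Y2 : q`_2 * e4 + q`_1 * e3 + q`_0 * e2 < 0.
  by move: Y2; rewrite /Y !coefMXaddC /e2 /e3 /e4; congr (_ < _); ring.
clearbody e1 e2 e3 e4; clear Y sq hq qhigh coefMXaddC.
move: (q`_0) (q`_1) (q`_2) q2 disc Y5 Y2 => u v w w0 disc Y5 Y2.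
have e10 : 0 < e1 by rewrite -(pmulr_lgt0 _ e20) (lt_le_trans _ e_ineq) // mulr_gt0.
have v0 : v < 0 by have := mulr_gt0 w0 e10; lra.
(* The chain [6 w u e2 < 6 w (- v) e3 <= w e1 (- v) e2 <= v^2 e2 < 4 w u e2]. *)
have H1 : w * (u * e2) <= w * (- v * e3).
  by rewrite ler_wpM2l ?ltW //; have := mulr_gt0 w0 e40; lra.
have H2 : (w * - v) * (6 * e3) <= (w * - v) * (e1 * e2).
  by rewrite ler_wpM2l // mulr_ge0 ?ltW // oppr_gt0.
have H3 : (- v * e2) * (w * e1) <= (- v * e2) * - v.
  by rewrite ler_wpM2l ?mulr_ge0 ?oppr_ge0 ?ltW //; lra.
have H4 : e2 * v ^+ 2 < e2 * (4 * w * u) by rewrite ltr_pM2l //; lra.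
have H5 : 0 <= e2 * v ^+ 2 by rewrite mulr_ge0 ?sqr_ge0 ?ltW.
nra.
Qed.

Lemma has_sign_seq_coef (R : realType) d (sigma : sign_seq d) (Y : {poly R}) i :
  has_sign_seq sigma Y -> (i <= d)%N ->
  Y`_i != 0 /\ (Y`_i < 0) = nth false sigma i.
Proof.
case=> _ cY lti; have := cY (Ordinal (lti : (i < d.+1)%N)).
by rewrite (tnth_nth false) => /signP.
Qed.

Lemma not_realizable_odd_pos (R : realType) d (sigma : sign_seq d) P :
  (forall i, odd i -> nth false sigma i = false) -> nth false sigma 0 = false ->
  (0 < P)%N -> ~ realizable R (sigma, (P, 0%N)).
Proof.
move=> hodd h0 P0 [Y [hY /= hP hN]]; have Y0 := has_sign_seq_neq0 hY.
have [] : P <> 0%N by apply/eqP; rewrite -lt0n.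
rewrite -hP /nb_pos_roots big1 // => x x0; apply: muNroot.
apply: no_pos_root_of_odd_coefs_ge0 x0 => [i oddi||z z0].
- case: (leqP i d) => [lid|ltdi]; last by rewrite nth_default // (proj1 hY).
  by have [_] := has_sign_seq_coef hY lid; rewrite hodd // => /negbT; rewrite -leNgt.
- by have [Y00] := has_sign_seq_coef hY (leq0n d); rewrite h0 lt0r Y00 leNgt => ->.
- exact: (no_root_in (A := fun z => z < 0)) hN _.
Qed.

Lemma not_realizable_four_neg (R : realType) :
  ~ @realizable R 6
     ([tuple pos; pos; neg; neg; neg; neg; pos], (0, 4))%N.
Proof.
case=> Y [hY /= hP hN].
have sgnY i (lti : (i <= 6)%N) := has_sign_seq_coef hY lti.
have [q [rs [hq DY]]] := split_real_roots (has_sign_seq_neq0 hY).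
have rs0 : 0 \notin rs.
  have [Y0 _] := sgnY 0%N isT; apply: contraNN Y0; rewrite -horner_coef0 DY => rs0.
  by apply/eqP/rootP; rewrite rootM root_prod_XsubC rs0 orbT.
move: hP hN; rewrite /nb_pos_roots /nb_neg_roots DY !count_roots_split // => hP hN.
have rsneg : all (< 0) rs.
  apply/allP => r rrs; move: hP => /eqP; rewrite -leqn0 leqNgt -has_count.
  move=> /hasPn/(_ r rrs); rewrite -leNgt le_eqVlt => /orP[/eqP r0|//].
  by rewrite -r0 rrs in rs0.
have srs : size rs = 4 by move: rsneg; rewrite all_count hN => /eqP.
have sq : size q = 3.
  have [sY _] := hY; move: sY; rewrite DY size_Mmonic ?rootless_neq0 ?monic_prod_XsubC //.
  by rewrite size_prod_XsubC srs addnS /= => /eqP; rewrite (eqn_add2r 4 _ 3) => /eqP.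
have q2 : 0 < q`_2.
  have [sY _] := hY; have [Y6] := sgnY 6 isT.
  have : lead_coef Y = lead_coef q by rewrite DY lead_coef_Mmonic ?monic_prod_XsubC.
  rewrite /lead_coef sY sq /= => <-.
  by rewrite lt0r Y6 leNgt => ->.
case: rs srs rsneg {rs0 hP hN} DY => [|a [|b [|c [|d []]]]] //= _.
rewrite andbT => /and4P[a0 b0 c0 d0] DY.
apply: (@quadratic_four_neg_roots _ q (- a) (- b) (- c) (- d)) => //;
  rewrite ?oppr_gt0 // !polyCN.
all: move: DY; rewrite !big_cons big_nil mulr1 !mulrA => <-.
- by have [_ ->] := sgnY 5 isT.
- by have [_ ->] := sgnY 2 isT.
Qed.

(** * Sign data as plain lists *)

(** The enumeration of ordinals behind tuples and cardinals is locked, while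
    lists indexed by [iota] compute: the finite verification is carried out on
    the latter. *)
Notation plain_data := (seq bool * (nat * nat))%type.

Definition untup d (D : sign_data d) : plain_data := (val D.1, D.2).

Definition plain_alt (E : plain_data) : plain_data :=
  ([seq odd i (+) nth false E.1 i | i <- iota 0 (size E.1)], (E.2.2, E.2.1)).
Definition plain_rev (E : plain_data) : plain_data := (rev E.1, E.2).
Definition plain_opp (E : plain_data) : plain_data := (map negb E.1, E.2).

(** The three involutions commute, except that for odd [d] exchanging
    [plain_alt] and [plain_rev] costs one [plain_opp]; so these eight data
    exhaust a class. *)
Definition plain_orbit (E : plain_data) : seq plain_data :=
  let s1 := [:: E; plain_alt E] in
  let s2 := s1 ++ map plain_rev s1 in
  s2 ++ map plain_opp s2.

Lemma untup_inj d : injective (@untup d).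
Proof. by move=> [s p] [s' p'] [/val_inj -> ->]. Qed.

Lemma val_sign_seqE d (sigma : sign_seq d) (s : seq bool) : size s = d.+1 ->
  (forall i : 'I_d.+1, tnth sigma i = nth false s i) -> val sigma = s.
Proof.
move=> ss eq_s; apply: (@eq_from_nth _ false) => [|i]; first by rewrite size_tuple.
have -> : size (val sigma) = d.+1 by apply: size_tuple.
by move=> ltid; rewrite -(eq_s (Ordinal ltid)) (tnth_nth false).
Qed.

Lemma untup_alt d (sigma : sign_seq d) P N :
  untup (alternate_signs sigma, (N, P)) = plain_alt (untup (sigma, (P, N))).
Proof.
congr pair; apply: val_sign_seqE => [|i]; first by rewrite size_map size_iota size_tuple.
rewrite tnth_mktuple (nth_map 0%N) ?nth_iota ?size_iota ?size_tuple //.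
by rewrite (tnth_nth false).
Qed.

Lemma untup_rev d (sigma : sign_seq d) P N :
  untup (reverse_signs sigma, (P, N)) = plain_rev (untup (sigma, (P, N))).
Proof.
congr pair; apply: val_sign_seqE => [|i]; first by rewrite size_rev size_tuple.
by rewrite tnth_mktuple nth_rev ?size_tuple // (tnth_nth false).
Qed.

Lemma untup_opp d (sigma : sign_seq d) P N :
  untup (opposite_signs sigma, (P, N)) = plain_opp (untup (sigma, (P, N))).
Proof.
congr pair; apply: val_sign_seqE => [|i]; first by rewrite size_map size_tuple.
by rewrite tnth_mktuple (nth_map false) ?size_tuple // (tnth_nth false).
Qed.

Lemma plain_orbit_equiv d (D D' : sign_data d) :
  untup D' \in plain_orbit (untup D) -> trivially_equivalent D D'.
Proof.
pose ok E := exists2 D0 : sign_data d, untup D0 = E & trivially_equivalent D D0.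
have okD : ok (untup D) by exists D => //; apply: TrivRefl.
have ok_alt E : ok E -> ok (plain_alt E).
  case=> -[sigma [P N]] <- DD0.
  by exists (alternate_signs sigma, (N, P)); [exact: untup_alt | exact: TrivNegX].
have ok_rev E : ok E -> ok (plain_rev E).
  case=> -[sigma [P N]] <- DD0.
  by exists (reverse_signs sigma, (P, N)); [exact: untup_rev | exact: TrivInvX].
have ok_opp E : ok E -> ok (plain_opp E).
  case=> -[sigma [P N]] <- DD0.
  by exists (opposite_signs sigma, (P, N)); [exact: untup_opp | exact: TrivNegY].
suff all_ok E : E \in plain_orbit (untup D) -> ok E.
  by move=> /all_ok[D0 /untup_inj <-].
have okA := ok_alt _ okD.
by rewrite !inE; do 7 (case/orP => [/eqP->|]; first by eauto); move/eqP=> ->; eauto.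
Qed.

Definition plain_variations (s : seq bool) :=
  count (fun i => nth false s i != nth false s i.+1) (iota 0 (size s).-1).

Lemma plain_variationsE d (sigma : sign_seq d) :
  variations sigma = plain_variations sigma.
Proof.
rewrite /variations /plain_variations size_tuple -sum1dep_card -sum1_count.
have -> : iota 0 d.+1.-1 = index_iota 0 d by rewrite /index_iota subn0.
by rewrite big_mkord; apply: eq_bigl => i; rewrite !(tnth_nth false).
Qed.

Definition plain_compatible (E : plain_data) :=
  let: (s, (P, N)) := E in
  let k := plain_variations s in
  let k' := plain_variations (plain_alt E).1 in
  [&& (P <= k)%N, ~~ odd (k - P), (N <= k')%N & ~~ odd (k' - N)].

Lemma Descartes_compatible_plain d (sigma : sign_seq d) P N :
  Descartes_compatible sigma P N -> plain_compatible (untup (sigma, (P, N))).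
Proof.
have Ealt : variations (alternate_signs sigma) =
    plain_variations (plain_alt (untup (sigma, (P, N)))).1.
  by rewrite -untup_alt plain_variationsE.
rewrite /Descartes_compatible Ealt plain_variationsE => -[*]; exact/and4P.
Qed.

(** * Certificates *)

(** Polynomials are locked; products of coefficient lists compute. *)
Fixpoint coefs_add (R : nmodType) (s t : seq R) : seq R :=
  match s, t with
  | a :: s', b :: t' => a + b :: coefs_add s' t'
  | [::], _ => t
  | _, [::] => s
  end.

Fixpoint coefs_mul (R : pzSemiRingType) (s t : seq R) : seq R :=
  if s is a :: s' then coefs_add [seq a * b | b <- t] (0 :: coefs_mul s' t)
  else [::].

Lemma Poly_coefs_add (R : nzRingType) (s t : seq R) :
  Poly (coefs_add s t) = Poly s + Poly t.
Proof.
elim: s t => [|a s IH] [|b t] /=; rewrite ?add0r ?addr0 //.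
by rewrite !cons_poly_def IH polyCD mulrDl addrACA.
Qed.

Lemma Poly_coefs_mul (R : comNzRingType) (s t : seq R) :
  Poly (coefs_mul s t) = Poly s * Poly t.
Proof.
elim: s => [|a s IH] /=; first by rewrite mul0r.
rewrite Poly_coefs_add; have -> : Poly [seq a * b | b <- t] = a%:P * Poly t.
  apply/polyP => i; rewrite coefCM !coef_Poly.
  by elim: t i {IH} => [|b t IH] [|i] //=; rewrite mulr0.
by rewrite /= !cons_poly_def addr0 IH; ring.
Qed.

Lemma Poly_foldr_coefs_mul (R : comNzRingType) (ss : seq (seq R)) :
  Poly (foldr (@coefs_mul R) [:: 1] ss) = \prod_(s <- ss) Poly s.
Proof.
elim: ss => [|s ss IH]; first by rewrite big_nil /= cons_poly_def mul0r add0r.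
by rewrite /= Poly_coefs_mul IH big_cons.
Qed.

(** A list of roots [r] and a list of pairs [(b, c)] standing for
    [X^2 + b X + c]. *)
Definition certificate := (seq int * seq (int * int))%type.

Definition certificate_coefs (c : certificate) : seq int :=
  foldr (@coefs_mul int) [:: 1]
    ([seq [:: q.2; q.1; 1] | q <- c.2] ++ [seq [:: - r; 1] | r <- c.1]).

Definition certificate_data (c : certificate) : plain_data :=
  ([seq a < 0 | a <- certificate_coefs c],
   (count (fun r => 0 < r) c.1, count (fun r => r < 0) c.1)).

Definition certificate_ok (d : nat) (c : certificate) :=
  [&& size (certificate_coefs c) == d.+1, 0 \notin certificate_coefs c &
      all (fun q => q.1 ^+ 2 < 4 * q.2) c.2].

Lemma certificate_realizable (R : realType) d (D : sign_data d) (c : certificate) :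
  certificate_ok d c -> untup D = certificate_data c -> realizable R D.
Proof.
case/and3P => /eqP sc coefs0 /allP hdisc [Dsgn DPN].
pose Q := \prod_(q <- c.2) (Poly [:: q.2%:~R; q.1%:~R; 1] : {poly R}).
have hQ : rootless Q.
  rewrite /Q; elim: (c.2) hdisc => [|q qs IH] hdisc.
    by move=> x; rewrite big_nil root1.
  rewrite big_cons; apply: rootlessM; last first.
    by apply: IH => q' q'qs; apply: hdisc; rewrite inE q'qs orbT.
  have sq : size (Poly [:: q.2%:~R; q.1%:~R; 1] : {poly R}) = 3.
    by rewrite (@PolyK _ 0) //= oner_eq0.
  apply/(Num.Theory.Pdeg2.Real.deg2_poly_noroot sq).
  rewrite !coef_Poly /= mulr1 subr_lt0 -[4]/(4%:~R) -intrM -rmorphXn ltr_int.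
  by rewrite hdisc // mem_head.
pose Y := Q * \prod_(r <- [seq r%:~R | r <- c.1]) ('X - r%:P).
have DY : Y = map_poly intr (Poly (certificate_coefs c)).
  rewrite /certificate_coefs Poly_foldr_coefs_mul big_cat.
  rewrite rmorphM !rmorph_prod !big_map /Y /Q big_map.
  congr (_ * _); apply: eq_bigr => i _; apply/polyP=> k.
    rewrite coef_map !coef_Poly.
    by case: k => [|[|[|k]]] /=; rewrite ?nth_nil ?rmorph1 ?rmorph0.
  rewrite coef_map coef_Poly coefB coefX coefC.
  by case: k => [|[|k]] /=; rewrite ?nth_nil ?sub0r ?subr0 ?oppr0 ?rmorphN.
have coefY i : Y`_i = ((certificate_coefs c)`_i)%:~R.
  by rewrite DY coef_map coef_Poly.
have coef_neq0 i : (i < d.+1)%N -> (certificate_coefs c)`_i != 0.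
  by rewrite -sc => lti; apply: contraNneq coefs0 => <-; apply: mem_nth.
exists Y; split.
- split.
    apply/eqP; rewrite eqn_leq; apply/andP; split.
      by apply/leq_sizeP => j lej; rewrite coefY nth_default ?sc.
    have: Y`_d != 0 by rewrite coefY intr_eq0 coef_neq0.
    by apply: contraNltn => /leq_sizeP/(_ d (leqnn d)) ->.
  move=> i; rewrite coefY (tnth_nth false) Dsgn (nth_map 0) ?sc //.
  have := coef_neq0 i (ltn_ord i); case: ltrgt0P => // ai _.
    by rewrite gtr0_sg ?ltr0z.
  by rewrite ltr0_sg ?ltrz0.
- rewrite /nb_pos_roots count_roots_split // count_map DPN.
  by apply: eq_count => r /=; rewrite ltr0z.
- rewrite /nb_neg_roots count_roots_split // count_map DPN.
  by apply: eq_count => r /=; rewrite ltrz0.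
Qed.

(** * Every compatible datum is covered *)

(** The entries are ordered by the number of quadratic factors, then by the
    numbers of positive and negative roots. *)
Definition certificates : seq certificate := [::
   ([:: -1; -1; -1; -1; -1; 6], [::]);
   ([:: -1; -1; -1; -1; 1; 1], [::]);
   ([:: -1; -1; -1; -1; 1; 2], [::]);
   ([:: -1; -1; -1; -1; 2; 3], [::]);
   ([:: -1; -1; -1; -1; 3; 3], [::]);
   ([:: -8; -8; -7; -7; 1; 1], [::]);
   ([:: -9; -8; -1; -1; 3; 3], [::]);
   ([:: -5; -4; -4; -3; 1; 16], [::]);
   ([:: -1; -1; -1; 1; 1; 2], [::]);
   ([:: -3; -3; -3; 1; 1; 1], [::]);
   ([:: -2; -2; -2; 1; 3; 3], [::]);
   ([:: -3; -1; -1; 4; 4; 4], [::]);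
   ([:: -7; -2; -2; 1; 4; 5], [::]);
   ([:: -1; -1; -1; 8; 8; 9], [::]);
   ([:: -6; -5; -5; 1; 1; 15], [::]);
   ([:: -5; -1; 3; 3; 4; 4], [::]);
   ([:: -5; -4; 1; 1; 1; 8], [::]);
   ([:: -1; 1; 1; 1; 1; 2], [::]);
   ([:: -3; 1; 1; 1; 1; 1], [::]);
   ([:: 1; 1; 1; 1; 1; 1], [::]);
   ([:: -1; -1; -1; -1], [:: (-3, 3)]);
   ([:: -3; -2; -2; -2], [:: (-2, 2)]);
   ([:: -5; -5; -4; -3], [:: (-1, 1)]);
   ([:: -5; -5; -4; -3], [:: (-2, 2)]);
   ([:: -7; -6; -5; -5], [:: (-5, 7)]);
   ([:: -2; -2; -2; 1], [:: (-1, 1)]);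
   ([:: -2; -1; -1; 2], [:: (-1, 3)]);
   ([:: -4; -3; -3; 1], [:: (0, 1)]);
   ([:: -4; -3; -2; 7], [:: (-3, 3)]);
   ([:: -4; -3; -2; 9], [:: (-1, 1)]);
   ([:: -1; -1; 1; 1], [:: (1, 1)]);
   ([:: -2; -1; 1; 1], [:: (0, 2)]);
   ([:: -1; -1; 2; 2], [:: (0, 1)]);
   ([:: -2; -1; 1; 1], [:: (2, 2)]);
   ([:: -1; -1; 2; 2], [:: (1, 1)]);
   ([:: -4; -1; 2; 2], [:: (0, 1)]);
   ([:: -4; -1; 2; 2], [:: (0, 2)]);
   ([:: -1; -1; 3; 4], [:: (0, 2)]);
   ([:: -6; -6; 2; 2], [:: (1, 1)]);
   ([:: -1; 1; 1; 2], [:: (1, 1)]);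
   ([:: -1; 1; 1; 1], [:: (0, 2)]);
   ([:: -2; 1; 1; 1], [:: (0, 1)]);
   ([:: -2; 1; 1; 1], [:: (2, 2)]);
   ([:: -3; 1; 1; 1], [:: (1, 1)]);
   ([:: -2; 2; 2; 3], [:: (1, 1)]);
   ([:: -1; 2; 3; 3], [:: (1, 1)]);
   ([:: -4; 1; 2; 2], [:: (2, 2)]);
   ([:: 1; 1; 1; 1], [:: (1, 1)]);
   ([:: 1; 1; 1; 2], [:: (2, 2)]);
   ([:: 2; 2; 2; 3], [:: (4, 5)]);
   ([:: -1; -1], [:: (-1, 1); (0, 1)]);
   ([:: -2; -1], [:: (-1, 1); (-1, 1)]);
   ([:: -2; -1], [:: (-2, 2); (-2, 2)]);
   ([:: -1; -1], [:: (-3, 3); (0, 1)]);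
   ([:: -2; -1], [:: (-3, 3); (1, 3)]);
   ([:: -3; -2], [:: (-3, 3); (0, 1)]);
   ([:: -4; -3], [:: (-1, 1); (-1, 1)]);
   ([:: -2; -2], [:: (-4, 12); (-1, 1)]);
   ([:: -2; 1], [:: (-1, 1); (1, 1)]);
   ([:: -1; 1], [:: (-1, 1); (0, 2)]);
   ([:: -1; 1], [:: (-2, 2); (1, 2)]);
   ([:: -2; 1], [:: (0, 1); (0, 2)]);
   ([:: -1; 1], [:: (-1, 1); (2, 3)]);
   ([:: -2; 1], [:: (-1, 1); (2, 3)]);
   ([:: -2; 1], [:: (-3, 3); (1, 1)]);
   ([:: -1; 2], [:: (-2, 2); (2, 3)]);
   ([:: -1; 2], [:: (-2, 3); (2, 2)]);
   ([:: -3; 2], [:: (-1, 2); (1, 1)]);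
   ([:: 1; 2], [:: (0, 1); (2, 2)]);
   ([:: 1; 2], [:: (-1, 1); (3, 3)]);
   ([:: 2; 3], [:: (0, 1); (1, 1)]);
   ([:: 1; 3], [:: (1, 2); (2, 2)]);
   ([:: 1; 1], [:: (-3, 3); (2, 2)]);
   ([:: 1; 3], [:: (0, 2); (3, 3)]);
   ([:: 2; 2], [:: (2, 2); (3, 3)]);
   ([:: 3; 3], [:: (-1, 4); (3, 3)]);
   ([:: 3; 4], [:: (-1, 5); (4, 5)]);
   ([::], [:: (-1, 1); (-1, 1); (1, 1)]);
   ([::], [:: (-2, 2); (1, 1); (2, 3)]);
   ([::], [:: (-3, 3); (1, 1); (1, 2)]);
   ([::], [:: (-3, 3); (-1, 1); (3, 3)]);
   ([::], [:: (-3, 3); (-1, 1); (3, 4)]);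
   ([::], [:: (-4, 5); (0, 1); (3, 3)]);
   ([::], [:: (-2, 2); (-1, 1); (4, 5)]);
   ([::], [:: (-4, 5); (1, 5); (4, 5)]);
   ([::], [:: (-4, 5); (0, 5); (5, 7)]);
   ([::], [:: (-5, 9); (0, 9); (6, 10)])].

Fixpoint all_signs n : seq (seq bool) :=
  if n is n'.+1 then
    [seq false :: s | s <- all_signs n'] ++ [seq true :: s | s <- all_signs n']
  else [:: [::]].

Lemma mem_all_signs (s : seq bool) : s \in all_signs (size s).
Proof.
by elim: s => [|b s IH] //=; rewrite mem_cat; case: b; rewrite map_f ?orbT.
Qed.

(** The list [L] is a parameter so that call by value evaluates it once. *)
Definition covered (n : nat) (L : seq plain_data) :=
  all (fun s => all (fun P => all (fun N =>
    plain_compatible (s, (P, N)) ==> ((s, (P, N)) \in L))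
    (iota 0 n)) (iota 0 n)) (all_signs n).

Lemma covered_mem n L (s : seq bool) P N : size s = n -> (P < n)%N -> (N < n)%N ->
  covered n L -> plain_compatible (s, (P, N)) -> (s, (P, N)) \in L.
Proof.
move=> <- ltP ltN /allP/(_ s (mem_all_signs s))/allP/(_ P) + compat.
rewrite mem_iota ltP => /(_ isT)/allP/(_ N); rewrite mem_iota ltN => /(_ isT).
by rewrite compat.
Qed.

Lemma variations_lt d (sigma : sign_seq d) : (variations sigma < d.+1)%N.
Proof. by rewrite ltnS -[leqRHS]card_ord max_card. Qed.

(** Data with [P] or [N] at least 7 are not compatible, since a sequence of 7
    signs has at most 6 variations. *)
Lemma certificates_cover :
  covered 7 (flatten (map plain_orbit
    (map (@untup 6) exceptional_data ++ map certificate_data certificates))).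
Proof. by vm_compute. Qed.

Lemma certificates_ok : all (certificate_ok 6) certificates.
Proof. by vm_compute. Qed.

Theorem mainTheorem4 (R : realType) (sigma : sign_seq 6) (P N : nat)
    (hcompat : Descartes_compatible sigma P N) :
  let exceptional := exists D : sign_data 6,
    D \in exceptional_data /\ trivially_equivalent D (sigma, (P, N)) in
  (~ exceptional -> exists Y : {poly R}, realizes sigma P N Y) /\
  (exceptional -> ~ exists Y : {poly R}, realizes sigma P N Y).
Proof.
move=> exceptional; split => [not_exc | [D [excD equivD]]]; last first.
  rewrite -/(realizable R (sigma, (P, N))) (realizable_equiv R equivD).
  move: excD; rewrite !inE => /or4P[] /eqP->; last exact: not_realizable_four_neg.
  1-3: apply: not_realizable_odd_pos => //.
  1-3: by case=> [|[|[|[|[|[|[|i]]]]]]] //=; rewrite nth_nil.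
have [leP _ leN _] := hcompat.
have := covered_mem (size_tuple sigma) (leq_ltn_trans leP (variations_lt _))
  (leq_ltn_trans leN (variations_lt _)) certificates_cover
  (Descartes_compatible_plain hcompat).
case/flatten_mapP => -[s PN]; rewrite mem_cat => /orP[] /mapP[].
  move=> D excD -> /(@plain_orbit_equiv _ _ (sigma, (P, N))) equivD.
  by case: not_exc; exists D.
move=> c /(allP certificates_ok) okc Ds.
have ss : size s == 7 by have /and3P[] := okc; case: Ds => ->; rewrite size_map.
pose D : sign_data 6 := (Tuple ss, PN).
move=> /(@plain_orbit_equiv _ D (sigma, (P, N))) equivD.
by apply/(realizable_equiv R equivD); exact: (@certificate_realizable R 6 D c okc Ds).
Qed.
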